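(* For all integers $d \geq 2$ and $n \geq d(d+2)$, there exists a connected graph $G$ on $n$ vertices with minimum degree $d$ such that every spanning tree $T$ of $G$ has an internal vertex whose degree in $T$ is equal to $2$.
   Context: Graphs are finite, simple and undirected. An internal vertex of a tree $T$ is a vertex of $T$ that is not a leaf, i.e. a vertex whose degree in $T$ is at least $2$. *)

(* Defs.v *)
From mathcomp Require Import all_boot.

Set Implicit Arguments.
Unset Strict Implicit.
Unset Printing Implicit Defensive.

Record sgraph (V : finType) := SGraph {
  adj :> rel V;
  adj_sym : symmetric adj;
  adj_irrefl : irreflexive adj
}.

Section Graphs.

Variable V : finType.
Implicit Types G T : sgraph V.

Definition degree G (x : V) : nat := #|[set y | G x y]|.

(* #|V| is only the value on the empty graph: every degree is smaller, so on
   a nonempty vertex set this is the minimum of the degrees. *)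
Definition min_degree G : nat := \big[minn/#|V|]_(x : V) degree G x.

Definition connected G : Prop := 0 < #|V| /\ forall x y : V, connect G x y.

(* The bound on the size is needed: ucycle also holds of [::] and of
   [:: x; y] for an edge xy. *)
Definition acyclic G : Prop :=
  forall c : seq V, 3 <= size c -> ~ ucycle G c.

Definition is_tree G : Prop := connected G /\ acyclic G.

Definition spanning_tree G T : Prop := is_tree T /\ subrel T G.

Definition internal_vertex T (x : V) : bool := 2 <= degree T x.

End Graphs.

(* Main.v *)
Require Import Defs.
From mathcomp Require Import all_boot zify.

Set Implicit Arguments.
Unset Strict Implicit.
Unset Printing Implicit Defensive.

(** Attach to every vertex [w] of a complete graph [K_d] its own clique on at
    least [d + 1] vertices, by a single edge.  These edges are bridges, so every
    spanning tree [T] contains them and induces a tree on [K_d].  As [d >= 2],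
    the latter has a leaf; its degree in [T] is [2], one for the edge inside
    [K_d] and one for the bridge. *)

Section AcyclicLeaf.

Variables (V : finType) (T : sgraph V).

(** If [y] came after [z], the edge from [x] to [y] would close the stretch of path from [x] to [y]
    into a cycle on at least three vertices. *)
Lemma acyclic_chord (x y z : V) (p : seq V) :
  acyclic T -> path T x (z :: p) -> uniq (x :: z :: p) ->
  T x y -> y \in z :: p -> y = z.
Proof.
move=> acT pth unq Txy; rewrite inE => /predU1P[// | yp].
case/splitPr: yp pth unq => p1 p2 pth unq.
case: (acT (x :: z :: rcons p1 y)); first by rewrite /= size_rcons.
have : path T x (z :: rcons p1 y ++ p2) by rewrite cat_rcons.
rewrite -cat_cons cat_path => /andP[pth1 _].
have : uniq ((x :: z :: rcons p1 y) ++ p2) by rewrite /= cat_rcons.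
rewrite cat_uniq => /andP[unq1 _].
rewrite /ucycle unq1 andbT /cycle rcons_path pth1 /= last_rcons.
by rewrite adj_sym.
Qed.

(** While the end of a path has two neighbours in [A], one of them differs from its predecessor and,
    by acyclicity, is new. So the path grows, which cannot go on forever. *)
Lemma acyclic_leaf (A : {set V}) :
  acyclic T -> A != set0 ->
  exists2 x, x \in A & #|[set y in A | T x y]| <= 1.
Proof.
move=> acT /set0Pn[x0 x0A].
(* The path grows at the front: [x] is its newest vertex and [head x p] the previous one. The fuel
   [k] bounds the extensions left; at [k = 0] there would be more than [#|V|] distinct vertices. *)
suff grow k x p : #|V| <= k + size p -> path T x p -> uniq (x :: p) ->
    x \in A -> exists2 x, x \in A & #|[set y in A | T x y]| <= 1.
  by apply: (grow #|V| x0 [::]) => //; rewrite addn0.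
elim: k x p => [|k IHk] x p le_k pth unq xA.
  have := leq_trans (max_card (mem (x :: p))) le_k.
  by rewrite (card_uniqP unq) /= add0n ltnn.
have [small | big] := leqP #|[set y in A | T x y]| 1; first by exists x.
have [y [yA Txy y_head]] : exists y, [/\ y \in A, T x y & y != head x p].
  case/card_gt1P: big => a [b [+ + neq_ab]].
  rewrite !inE => /andP[aA Txa] /andP[bA Txb].
  have [ah | ah] := eqVneq a (head x p); last by exists a.
  by exists b; split; rewrite // -ah eq_sym.
apply: (IHk y (x :: p)) => //=; first by rewrite addnS.
  by rewrite adj_sym Txy.
rewrite [_ && uniq p]unq andbT inE negb_or; apply/andP; split.
  by apply: contraTneq Txy => ->; rewrite adj_irrefl.
case: p pth unq y_head {le_k} => [// | z p] pth unq y_head.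
by apply: contraNN y_head => yp; apply/eqP; apply: (acyclic_chord acT pth unq Txy yp).
Qed.

End AcyclicLeaf.

(** A set that no edge leaves is closed under [connect], hence cannot separate [a] from [b]. *)
Lemma connected_boundary (V : finType) (T : sgraph V) (A : {set V}) (a b : V) :
  connected T -> a \in A -> b \notin A ->
  exists x y, [/\ T x y, x \in A & y \notin A].
Proof.
case=> _ conT aA bA.
have [/existsP[x /existsP[y /and3P[Txy xA yA]]] | no_edge] :=
  boolP [exists x, exists y, [&& T x y, x \in A & y \notin A]].
  by exists x, y.
suff clA : closed T A by rewrite -(closed_connect clA (conT a b)) aA in bA.
apply: intro_closed => [|x y Txy xA]; first exact/sym_connect_sym/adj_sym.
apply: contraNT no_edge => yA.
by apply/existsP; exists x; apply/existsP; exists y; rewrite Txy xA.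
Qed.

Lemma min_degree_eq (V : finType) (G : sgraph V) (d : nat) (x : V) :
  (forall y, d <= degree G y) -> degree G x = d -> min_degree G = d.
Proof.
move=> ge_d x_d; apply/eqP; rewrite eqn_leq; apply/andP; split.
  rewrite /min_degree; have := mem_index_enum x.
  elim: (index_enum V) => // y s IHs; rewrite big_cons inE geq_min.
  by case/predU1P=> [<- | /IHs->]; rewrite ?x_d ?leqnn ?orbT.
apply: (big_ind (fun m => d <= m)) => [|m1 m2 d1 d2|y _].
(* The default value [#|V|] is at least [d], because [d] is itself a degree. *)
- by rewrite -x_d max_card.
- by rewrite leq_min d1.
- exact: ge_d.
Qed.

Section Corona.

Variables d n : nat.

(* The core is [[0, d)]; the clique attached to the core vertex [w] consists of
   the [x >= d] congruent to [w] modulo [d], and meets the bridge at [w + d]. *)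
Definition corona_rel : rel 'I_n := fun x y =>
  (x != y) && [|| (x < d) && (y < d),
                  [&& d <= x, d <= y & x == y %[mod d]],
                  (x < d) && (y == x + d :> nat)
                | (y < d) && (x == y + d :> nat)].

Lemma corona_sym : symmetric corona_rel.
Proof.
move=> x y; rewrite /corona_rel eq_sym [x %% d == _]eq_sym; congr (_ && _).
rewrite [(y < d) && (x < d)]andbC [[&& d <= y, _ & _]]andbCA; congr (_ || (_ || _)).
exact: orbC.
Qed.

Lemma corona_irrefl : irreflexive corona_rel.
Proof. by move=> x; rewrite /corona_rel eqxx. Qed.

Definition corona : sgraph 'I_n := SGraph corona_sym corona_irrefl.

Hypotheses (hd : 2 <= d) (hn : d * (d + 2) <= n).

Let core : {set 'I_n} := [set x : 'I_n | x < d].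
Let clique (w : nat) : {set 'I_n} := [set x : 'I_n | (d <= x) && (x %% d == w)].

Lemma card_core : #|core| = d.
Proof.
have le_dn : d <= n by nia.
have -> : core = [set widen_ord le_dn i | i : 'I_d].
  apply/setP=> x; rewrite inE; apply/idP/imsetP => [xd | [i _ ->]].
    by exists (Ordinal xd) => //; apply: val_inj.
  exact: (ltn_ord i).
rewrite card_imset ?card_ord // => i j /(congr1 val) /= ij; exact: val_inj.
Qed.

Lemma card_clique w : w < d -> d < #|clique w|.
Proof.
move=> wd.
(* The largest of these [d + 1] elements is at most [(d - 1) + (d + 1) * d = d * (d + 2) - 1]: this
   is where the bound on [n] comes from. *)
have bnd (i : 'I_d.+1) : w + i.+1 * d < n by have := ltn_ord i; nia.
rewrite -[d.+1]card_ord -(@card_imset _ _ (fun i => Ordinal (bnd i))); last first.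
  by move=> i j /(congr1 val) /= ij; apply: val_inj => /=; nia.
apply: subset_leq_card; apply/subsetP=> _ /imsetP[i _ ->].
by rewrite inE /= addnC modnMDl modn_small // eqxx andbT; nia.
Qed.

Lemma bridge_end (w : 'I_n) : w < d -> exists r : 'I_n, r = w + d :> nat.
Proof.
move=> wd; have rn : w + d < n by nia.
by exists (Ordinal rn).
Qed.

(** There are [d - 1] other core vertices and one bridge end. *)
Lemma degree_core (w : 'I_n) : w < d -> degree corona w = d.
Proof.
move=> wd; have [r rE] := bridge_end wd.
rewrite /degree.
have -> : [set y | corona w y] = r |: (core :\ w).
  apply/setP=> y; rewrite !inE /= /corona_rel -!val_eqE /= rE wd.
  by rewrite [d <= w]leqNgt wd /=; lia.
have wcore : w \in core by rewrite inE.
rewrite cardsU1 !inE rE ltnNge leq_addl andbF.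
by rewrite -[in RHS]card_core (cardsD1 w core) wcore.
Qed.

Lemma degree_clique (x : 'I_n) : d <= x -> d <= degree corona x.
Proof.
move=> dx; have d0 : 0 < d by lia.
have := card_clique (ltn_pmod x d0); rewrite (cardsD1 x) inE dx eqxx /= add1n ltnS.
move=> /leq_trans; apply; apply: subset_leq_card; apply/subsetP=> y.
rewrite !inE /= /corona_rel => /and3P[yx dy /eqP->].
by rewrite eq_sym yx dx dy eqxx orbT.
Qed.

Lemma corona_min_degree : min_degree corona = d.
Proof.
have n0 : 0 < n by nia.
apply: (@min_degree_eq _ _ _ (Ordinal n0)) => [y|]; last by apply: degree_core => /=; lia.
by have [/degree_clique | /degree_core ->] := leqP d y.
Qed.

Lemma corona_connected : connected corona.
Proof.
have d0 : 0 < d by lia.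
split=> [|x y]; first by rewrite card_ord; nia.
have csym : connect_sym corona by apply: sym_connect_sym; apply: adj_sym.
(* Outside the core, move within the clique to its bridge end [r], then cross to [z %% d]. *)
have to_core z : exists2 w : 'I_n, w < d & connect corona z w.
  have [dz | zd] := leqP d z; last by exists z.
  have wn : z %% d < n by apply: leq_ltn_trans (leq_mod z d) (ltn_ord z).
  pose w := Ordinal wn; have wd : w < d by rewrite /= ltn_pmod.
  have [r rE] := bridge_end wd; exists w => //.
  apply: (@connect_trans _ _ r).
    have [-> // | zr] := eqVneq z r; apply: connect1.
    by rewrite /= /corona_rel zr dz rE leq_addl modnDr /= modn_mod eqxx orbT.
  apply: connect1; rewrite /= /corona_rel wd rE eqxx !orbT andbT.
  by rewrite -val_eqE /= rE /=; lia.
have [u ud xu] := to_core x; have [v vd yv] := to_core y.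
apply: (connect_trans xu); rewrite csym; apply: (connect_trans yv).
have [-> // | vu] := eqVneq v u; apply: connect1.
by rewrite /= /corona_rel vu ud vd.
Qed.

Lemma corona_core_neighbour (w r y : 'I_n) : w < d -> r = w + d :> nat ->
  corona w y -> (y < d) || (y == r).
Proof.
move=> wd rE; rewrite /= /corona_rel wd [d <= w]leqNgt wd /= -!val_eqE /= rE.
by lia.
Qed.

(** This makes the edge between [w] and [w + d] a bridge: other edges at a clique vertex keep the
    residue and stay outside the core. *)
Lemma corona_clique_exit (w x y : 'I_n) : w < d -> corona x y ->
  x \in clique w -> y \notin clique w -> y = w /\ x = w + d :> nat.
Proof.
move=> wd; rewrite !inE /= /corona_rel => /andP[_ xy] /andP[dx /eqP xw].
move: xy; rewrite [x < d]ltnNge dx /=.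
case/orP => [/andP[dy /eqP xy] | /andP[yd /eqP xE] _].
  by rewrite dy -xy xw eqxx.
suff yw : y = w by rewrite -yw.
by apply: val_inj; rewrite /= -xw xE modnDr modn_small.
Qed.

Lemma spanning_tree_corona (T : sgraph 'I_n) :
  spanning_tree corona T -> exists x, degree T x = 2.
Proof.
case=> -[conT acT] subT.
have core0 : core != set0 by rewrite -card_gt0 card_core; lia.
have [w + leaf] := acyclic_leaf acT core0; rewrite inE => wd.
have [r rE] := bridge_end wd.
have w_r : r \in clique w by rewrite inE rE leq_addl modnDr modn_small //=.
have w_w : w \notin clique w by rewrite inE leqNgt wd.
have Twr : T w r.
  have [x [y [Txy xQ yQ]]] := connected_boundary conT w_r w_w.
  have [yw xE] := corona_clique_exit wd (subT _ _ Txy) xQ yQ.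
  have <- : x = r by apply: val_inj; rewrite /= xE rE.
  by rewrite -yw adj_sym.
(* As [d >= 2], [T] must leave [w] together with its clique. The clique exits only to [w], so the
   leaving edge starts at [w]; it avoids [r], which lies in the clique, and thus ends in the
   core. *)
have [u uT] : exists u, u \in [set y in core | T w y].
  have [v vcore vw] : exists2 v, v \in core & v != w.
    have : 0 < #|core :\ w|.
      have := cardsD1 w core; rewrite card_core inE wd; lia.
    by case/card_gt0P=> v; rewrite in_setD1 => /andP[]; exists v.
  have vA : v \notin w |: clique w.
    by move: vcore; rewrite !inE (negPf vw) [d <= v]leqNgt => ->.
  have [x [y []]] := connected_boundary conT (setU11 w (clique w)) vA.
  move=> Txy xA yA; have Gxy := subT _ _ Txy; move: yA.
  rewrite in_setU1 negb_or => /andP[yw yQ]; case/setU1P: xA => [xw | xQ].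
    subst x; exists y; rewrite !inE Txy andbT.
    case/orP: (corona_core_neighbour wd rE Gxy) => // /eqP y_r.
    by rewrite y_r w_r in yQ.
  by have [yE _] := corona_clique_exit wd Gxy xQ yQ; rewrite yE eqxx in yw.
exists w; rewrite /degree.
have -> : [set y | T w y] = r |: [set y in core | T w y].
  apply/setP=> y; rewrite !inE; apply/idP/idP => [Twy | /predU1P[-> // | /andP[] //]].
  by rewrite Twy andbT orbC; apply: corona_core_neighbour (subT _ _ Twy).
have one : #|[set y in core | T w y]| = 1.
  by apply/eqP; rewrite eqn_leq leaf; apply/card_gt0P; exists u.
by rewrite cardsU1 inE inE rE ltnNge leq_addl one.
Qed.

End Corona.

Theorem theorem2 (d n : nat) (hd : 2 <= d) (hn : d * (d + 2) <= n) :
  exists G : sgraph 'I_n,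
    [/\ connected G, min_degree G = d
      & forall T : sgraph 'I_n, spanning_tree G T ->
          exists x : 'I_n, internal_vertex T x /\ degree T x = 2].
Proof.
exists (corona d n); split.
- exact: corona_connected.
- exact: corona_min_degree.
- move=> T /(spanning_tree_corona hd hn)[x xT].
  by exists x; rewrite /internal_vertex xT.
Qed.
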